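(* Let $\mathcal R$ be a set of rules and $\mathrm{ar}$ an arity function such that for every rule $\ell\Rightarrow r\in\mathcal R$ both $\ell$ and $r$ respect $\mathrm{ar}$. Then $\to_{\mathcal R}$ is terminating if and only if every arity-respecting term is terminating under $\to_{\mathcal R}$.
   Context: Sorts $\mathcal S$; simple types are sorts and $\sigma\to\tau$ (right-associative). Pairwise disjoint sets $\mathcal F$ (function symbols), $\mathcal V$ (variables), each typed and containing infinitely many symbols of every type, and $\mathcal M$ (meta-variables), each with a declaration $[\sigma_1\times\dots\times\sigma_k]\to\tau$ ($k=\mathrm{ar}(Z)$). Meta-terms: variables, function symbols, typed application $s\,t$ (left-associative), abstraction $\lambda x.s$, and $Z\langle s_1,\dots,s_e\rangle:\tau$ for $Z:[\sigma_1\times\dots\times\sigma_k]\to\sigma_{k+1}\to\dots\to\sigma_e\to\tau$ with $s_i:\sigma_i$; modulo $\alpha$. Terms contain no meta-variables. Patterns: $Z\langle x_1,\dots,x_k\rangle$ (distinct variables, $k=\mathrm{ar}(Z)$), $\lambda x.\ell$, $a\,\ell_1\cdots\ell_n$ with $a\in\mathcal F\cup\mathcal V$. A substitution $\gamma$ maps variables to terms and $Z$ (arity $k$) to $\lambda y_1\dots y_k.u$; $\gamma(Z)\approx_e\lambda x_1\dots x_e.s$ iff $\gamma(Z)=\lambda x_1\dots x_e.s$ or $\gamma(Z)=\lambda x_1\dots x_i.t$ with $k\le i<e$, $t$ not an abstraction, $s=t\,x_{i+1}\cdots x_e$; $Z\langle s_1,\dots,s_e\rangle\gamma=t[x_1:=s_1\gamma,\dots,x_e:=s_e\gamma]$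 for $\gamma(Z)\approx_e\lambda x_1\dots x_e.t$, and otherwise substitution acts structurally and capture-avoidingly. A rule $\ell\Rightarrow r$ is a pair of closed meta-terms of the same type, $\ell$ a pattern $f\,\ell_1\cdots\ell_n$ with $f\in\mathcal F$, every meta-variable of $r$ occurring in $\ell$. $\to_{\mathcal R}$ is the smallest relation on terms closed under all contexts (also below $\lambda$) containing $\ell\delta\to r\delta$ ($\ell\Rightarrow r\in\mathcal R$, $\delta$ a substitution on the meta-variables of $\ell$) and $(\lambda x.s)t\to s[x:=t]$. A term is terminating if there is no infinite $\to_{\mathcal R}$-reduction from it; $\to_{\mathcal R}$ is terminating if every term is. An arity function is $\mathrm{ar}:\mathcal F\to\mathbb N$ with $\mathrm{ar}(f)\le m$ for $f:\sigma_1\to\dots\to\sigma_m\to\iota$; a (meta-)term respects $\mathrm{ar}$ if every occurrence of every $f$ in it is applied to at least $\mathrm{ar}(f)$ arguments. *)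

(* Defs.v *)
From Stdlib Require Import List Arith Bool.
Import ListNotations.

Set Implicit Arguments.
Unset Strict Implicit.

Inductive ty (S : Type) : Type :=
| Sort : S -> ty S
| Arr : ty S -> ty S -> ty S.

Definition arrows {S : Type} (ss : list (ty S)) (t : ty S) : ty S :=
  fold_right (@Arr S) t ss.

Fixpoint nargs {S : Type} (t : ty S) : nat :=
  match t with
  | Sort _ => 0
  | Arr _ t' => 1 + nargs t'
  end.

(* [margs Z = [s1; ..; sk]] and [mres Z = t] encode the declaration
   Z : [s1 x .. x sk] -> t, where [t] may itself be an arrow type. *)
Record signature : Type := {
  sort : Type;
  fsym : Type;
  var : Type;
  mvar : Type;
  ftype : fsym -> ty sort;
  vtype : var -> ty sort;
  margs : mvar -> list (ty sort);
  mres : mvar -> ty sort;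
  fsym_infinite : forall (s : ty sort) (l : list fsym),
    exists f, ftype f = s /\ ~ In f l;
  var_infinite : forall (s : ty sort) (l : list var),
    exists x, vtype x = s /\ ~ In x l
}.

Definition mar {G : signature} (Z : mvar G) : nat := length (margs Z).

(* Raw meta-terms.  To work modulo alpha, variables bound by a lambda are de
   Bruijn indices [Bnd i]; a variable [x] that is not bound is [Var x].  A
   dangling index stands for a variable bound by the surrounding context. *)
Inductive mterm (G : signature) : Type :=
| Var : var G -> mterm G
| Bnd : nat -> mterm G
| Fun : fsym G -> mterm G
| App : mterm G -> mterm G -> mterm G
| Lam : ty (sort G) -> mterm G -> mterm G
| Meta : mvar G -> list (mterm G) -> mterm G.

Arguments Var {G} _.
Arguments Bnd {G} _.
Arguments Fun {G} _.
Arguments App {G} _ _.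
Arguments Lam {G} _ _.
Arguments Meta {G} _ _.

Definition apps {G : signature} (a : mterm G) (ss : list (mterm G)) : mterm G :=
  fold_left App ss a.

Definition lams {G : signature} (ss : list (ty (sort G))) (s : mterm G)
  : mterm G := fold_right Lam s ss.

(* [E] lists the types of the dangling indices. *)
Inductive has_type {G : signature} (E : list (ty (sort G)))
  : mterm G -> ty (sort G) -> Prop :=
| T_Var (x : var G) : has_type E (Var x) (vtype x)
| T_Bnd (i : nat) (t : ty (sort G)) :
    nth_error E i = Some t -> has_type E (Bnd i) t
| T_Fun (f : fsym G) : has_type E (Fun f) (ftype f)
| T_App (s u : mterm G) (a b : ty (sort G)) :
    has_type E s (Arr a b) -> has_type E u a -> has_type E (App s u) b
| T_Lam (s : mterm G) (a b : ty (sort G)) :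
    has_type (a :: E) s b -> has_type E (Lam a s) (Arr a b)
| T_Meta (Z : mvar G) (ss : list (mterm G)) (ts : list (ty (sort G)))
    (t : ty (sort G)) :
    mres Z = arrows ts t ->
    Forall2 (has_type E) ss (margs Z ++ ts) ->
    has_type E (Meta Z ss) t.

Fixpoint metas {G : signature} (s : mterm G) : list (mvar G) :=
  match s with
  | Var _ | Bnd _ | Fun _ => []
  | App s u => metas s ++ metas u
  | Lam _ s => metas s
  | Meta Z ss => Z :: flat_map metas ss
  end.

Fixpoint free_vars {G : signature} (s : mterm G) : list (var G) :=
  match s with
  | Var x => [x]
  | Bnd _ | Fun _ => []
  | App s u => free_vars s ++ free_vars u
  | Lam _ s => free_vars s
  | Meta _ ss => flat_map free_vars ss
  end.

Definition is_term {G : signature} (s : mterm G) : Prop :=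
  metas s = [] /\ exists t, has_type [] s t.

Definition up_ren (r : nat -> nat) (i : nat) : nat :=
  match i with
  | 0 => 0
  | S j => S (r j)
  end.

Fixpoint ren {G : signature} (r : nat -> nat) (s : mterm G) : mterm G :=
  match s with
  | Var x => Var x
  | Bnd i => Bnd (r i)
  | Fun f => Fun f
  | App s u => App (ren r s) (ren r u)
  | Lam a s => Lam a (ren (up_ren r) s)
  | Meta Z ss => Meta Z (map (ren r) ss)
  end.

Definition up {G : signature} (g : nat -> mterm G) (i : nat) : mterm G :=
  match i with
  | 0 => Bnd 0
  | S j => ren S (g j)
  end.

Fixpoint subst {G : signature} (g : nat -> mterm G) (s : mterm G) : mterm G :=
  match s with
  | Var x => Var x
  | Bnd i => g i
  | Fun f => Fun f
  | App s u => App (subst g s) (subst g u)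
  | Lam a s => Lam a (subst (up g) s)
  | Meta Z ss => Meta Z (map (subst g) ss)
  end.

(* s[x1 := s1, .., xe := se] for [ss = [s1; ..; se]] and [s] the body of
   lambda x1 .. xe. s; in that body [x1] is the index [e - 1] and [xe] is [0]. *)
Definition inst {G : signature} (ss : list (mterm G)) (s : mterm G) : mterm G :=
  subst (fun i => nth i (rev ss) (Bnd (i - length ss))) s.

(* [body e w] is the [s] with w ~_e lambda x1 .. xe. s.  If [w] has at least [e]
   leading abstractions they are removed; if w = lambda x1 .. xi. t with i < e
   and [t] not an abstraction, the result is t x_{i+1} .. xe, with [t] lifted
   over the e - i additional variables. *)
Fixpoint body {G : signature} (e : nat) (w : mterm G) : mterm G :=
  match e, w with
  | 0, _ => w
  | S e', Lam _ w' => body e' w'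
  | S _, _ => apps (ren (Nat.add e) w) (map Bnd (rev (seq 0 e)))
  end.

(* The substitution is lifted below a lambda, so that the dangling indices of
   its values are not captured. *)
Fixpoint msubst {G : signature} (d : mvar G -> mterm G) (s : mterm G)
  : mterm G :=
  match s with
  | Var x => Var x
  | Bnd i => Bnd i
  | Fun f => Fun f
  | App s u => App (msubst d s) (msubst d u)
  | Lam a s => Lam a (msubst (fun Z => ren S (d Z)) s)
  | Meta Z ss => inst (map (msubst d) ss) (body (length ss) (d Z))
  end.

(* [d] is a well-typed substitution on the meta-variables of [l]; its values
   may use the variables of [E], which the surrounding context binds.  The
   values of [d] elsewhere are irrelevant. *)
Definition msubst_on {G : signature} (E : list (ty (sort G)))
    (d : mvar G -> mterm G) (l : mterm G) : Prop :=
  forall Z, In Z (metas l) ->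
    metas (d Z) = [] /\
    has_type E (d Z) (arrows (margs Z) (mres Z)) /\
    exists u, d Z = lams (margs Z) u.

Inductive is_var {G : signature} : mterm G -> Prop :=
| V_Var (x : var G) : is_var (Var x)
| V_Bnd (i : nat) : is_var (Bnd i).

Inductive pattern {G : signature} : mterm G -> Prop :=
| P_Meta (Z : mvar G) (xs : list (mterm G)) :
    length xs = mar Z -> Forall is_var xs -> NoDup xs -> pattern (Meta Z xs)
| P_Lam (a : ty (sort G)) (l : mterm G) : pattern l -> pattern (Lam a l)
| P_Fun (f : fsym G) (ls : list (mterm G)) :
    Forall pattern ls -> pattern (apps (Fun f) ls)
| P_Var (x : mterm G) (ls : list (mterm G)) :
    is_var x -> Forall pattern ls -> pattern (apps x ls).

Definition is_rule {G : signature} (l r : mterm G) : Prop :=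
  (exists t, has_type [] l t /\ has_type [] r t) /\
  free_vars l = [] /\ free_vars r = [] /\
  pattern l /\ (exists f ls, l = apps (Fun f) ls) /\
  incl (metas r) (metas l).

Inductive step {G : signature} (R : mterm G -> mterm G -> Prop)
    (E : list (ty (sort G))) : mterm G -> mterm G -> Prop :=
| S_Rule (l r : mterm G) (d : mvar G -> mterm G) :
    R l r -> msubst_on E d l -> step R E (msubst d l) (msubst d r)
| S_Beta (a : ty (sort G)) (s u : mterm G) :
    step R E (App (Lam a s) u) (inst [u] s)
| S_AppL (s s' u : mterm G) : step R E s s' -> step R E (App s u) (App s' u)
| S_AppR (s u u' : mterm G) : step R E u u' -> step R E (App s u) (App s u')
| S_Lam (a : ty (sort G)) (s s' : mterm G) :
    step R (a :: E) s s' -> step R E (Lam a s) (Lam a s').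

Definition red {G : signature} (R : mterm G -> mterm G -> Prop)
    (s t : mterm G) : Prop :=
  is_term s /\ is_term t /\ step R [] s t.

Definition terminating_term {G : signature} (R : mterm G -> mterm G -> Prop)
    (s : mterm G) : Prop :=
  ~ exists u : nat -> mterm G, u 0 = s /\ forall i, red R (u i) (u (S i)).

Definition terminating {G : signature} (R : mterm G -> mterm G -> Prop)
  : Prop := forall s, is_term s -> terminating_term R s.

Definition is_arity {G : signature} (ar : fsym G -> nat) : Prop :=
  forall f, ar f <= nargs (ftype f).

(* [n] counts the arguments to which [s] is applied. *)
Fixpoint respects_at {G : signature} (ar : fsym G -> nat) (n : nat)
    (s : mterm G) : bool :=
  match s with
  | Var _ | Bnd _ => true
  | Fun f => ar f <=? n
  | App s u => respects_at ar (S n) s && respects_at ar 0 u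
  | Lam _ s => respects_at ar 0 s
  | Meta _ ss => forallb (respects_at ar 0) ss
  end.

Definition respects {G : signature} (ar : fsym G -> nat) (s : mterm G) : Prop :=
  respects_at ar 0 s = true.

(* Main.v *)
(** Every symbol [f] applied to fewer than [ar f] arguments is replaced by
    (lambda w. w) (lambda x1 .. x_{ar f}. f x1 .. x_{ar f}).  The resulting map
    [expand] is stable under the renamings performed in a left-hand side, so a
    rule step [l d -> r d] from [s] is a rule step from [expand s]; up to beta
    reductions that remove superfluous expansions, the same contractum
    is reached.  Hence an infinite reduction from [s] yields one from the
    arity-respecting term [expand s].  The outer redex is there because
    [Z<s1, .., se>d] depends on the number of leading abstractions of [d Z]:
    plain eta-expansion would add some, the redex does not. *)

Require Import Defs.
From Stdlib Require Import List Arith Bool Lia Relations.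
From Stdlib Require Import FunctionalExtensionality ClassicalEpsilon.
Import ListNotations.

Set Implicit Arguments.
Unset Strict Implicit.

(** * Induction through the argument lists of meta-variables and patterns *)

Lemma mterm_nested_ind (G : signature) (P : mterm G -> Prop)
    (HVar : forall x, P (Var x)) (HBnd : forall i, P (Bnd i))
    (HFun : forall f, P (Fun f))
    (HApp : forall s u, P s -> P u -> P (App s u))
    (HLam : forall a s, P s -> P (Lam a s))
    (HMeta : forall Z ss, Forall P ss -> P (Meta Z ss)) :
  forall s, P s.
Proof.
  fix IH 1; intros [x|i|f|s u|a s|Z ss].
  - apply HVar.
  - apply HBnd.
  - apply HFun.
  - apply HApp; apply IH.
  - apply HLam, IH.
  - apply HMeta; induction ss; constructor; [apply IH|assumption].
Qed.

Lemma pattern_nested_ind (G : signature) (P : mterm G -> Prop)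
    (HMeta : forall Z xs, length xs = mar Z -> Forall is_var xs ->
      P (Meta Z xs))
    (HLam : forall a l, P l -> P (Lam a l))
    (HFun : forall f ls, Forall P ls -> P (apps (Fun f) ls))
    (HVar : forall x ls, is_var x -> Forall P ls -> P (apps x ls)) :
  forall l, pattern l -> P l.
Proof.
  fix IH 2; intros l [Z xs Hl Hxs _|a l' Hl'|f ls Hls|x ls Hx Hls].
  - exact (HMeta Z xs Hl Hxs).
  - apply HLam, IH, Hl'.
  - apply HFun; induction Hls; constructor; [apply IH|]; assumption.
  - apply HVar; [exact Hx|].
    induction Hls; constructor; [apply IH|]; assumption.
Qed.

(** * Renaming and substitution *)

Lemma up_Bnd (G : signature) (r : nat -> nat) :
  up (fun i => @Bnd G (r i)) = fun i => Bnd (up_ren r i).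
Proof. extensionality i; destruct i; reflexivity. Qed.

(** Renamings are substitutions by indices, so facts on substitution specialise to them. The
    composition laws below come in the order forced by lifting under binders: [subst_ren], then
    [ren_ren], then [ren_subst]. *)
Lemma ren_as_subst (G : signature) (s : mterm G) :
  forall r, ren r s = subst (fun i => Bnd (r i)) s.
Proof.
  induction s using mterm_nested_ind; intro r; simpl; auto.
  - rewrite IHs1, IHs2; reflexivity.
  - rewrite up_Bnd, IHs; reflexivity.
  - f_equal; apply map_ext_Forall; eapply Forall_impl; eauto; simpl; auto.
Qed.

Lemma subst_ren (G : signature) (s : mterm G) :
  forall g r, subst g (ren r s) = subst (fun i => g (r i)) s.
Proof.
  induction s using mterm_nested_ind; intros g r; simpl; auto.
  - rewrite IHs1, IHs2; reflexivity.
  - rewrite IHs; do 2 f_equal; extensionality i; destruct i; reflexivity.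
  - rewrite map_map; f_equal; apply map_ext_Forall.
    eapply Forall_impl; eauto; simpl; auto.
Qed.

Lemma subst_Bnd (G : signature) (s : mterm G) : subst Bnd s = s.
Proof.
  induction s using mterm_nested_ind; simpl; try congruence.
  - replace (up Bnd) with (@Bnd G); [congruence|].
    extensionality i; destruct i; reflexivity.
  - f_equal; rewrite <- (map_id ss) at 2; apply map_ext_Forall; assumption.
Qed.

Lemma ren_ren (G : signature) (s : mterm G) (r r' : nat -> nat) :
  ren r (ren r' s) = ren (fun i => r (r' i)) s.
Proof. rewrite (ren_as_subst (ren r' s)), subst_ren, ren_as_subst; reflexivity. Qed.

Lemma ren_subst (G : signature) (s : mterm G) :
  forall r g, ren r (subst g s) = subst (fun i => ren r (g i)) s.
Proof.
  induction s using mterm_nested_ind; intros r g; simpl; auto.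
  - rewrite IHs1, IHs2; reflexivity.
  - rewrite IHs; do 2 f_equal; extensionality i; destruct i; simpl;
      rewrite ?ren_ren; reflexivity.
  - rewrite map_map; f_equal; apply map_ext_Forall.
    eapply Forall_impl; eauto; simpl; auto.
Qed.

Lemma subst_up_ren (G : signature) (g : nat -> mterm G) (s : mterm G) :
  subst (up g) (ren S s) = ren S (subst g s).
Proof. rewrite subst_ren, ren_subst; reflexivity. Qed.

Lemma inst1_ren (G : signature) (u s : mterm G) : inst [u] (ren S s) = s.
Proof.
  unfold inst; rewrite subst_ren; rewrite <- (subst_Bnd s) at 2; f_equal.
  extensionality i; destruct i; reflexivity.
Qed.

Lemma metas_ren (G : signature) (s : mterm G) :
  forall r, metas (ren r s) = metas s.
Proof.
  induction s using mterm_nested_ind; intro r; simpl; auto.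
  - rewrite IHs1, IHs2; reflexivity.
  - f_equal; induction H; simpl; congruence.
Qed.

Lemma metas_subst_nil (G : signature) (s : mterm G) :
  forall g, metas s = [] -> (forall i, metas (g i) = []) ->
  metas (subst g s) = [].
Proof.
  induction s using mterm_nested_ind; intros g Hs Hg; simpl in *; auto.
  - apply app_eq_nil in Hs as [? ?]; rewrite IHs1, IHs2; auto.
  - apply IHs; auto; intros [|i]; simpl; rewrite ?metas_ren; auto.
  - discriminate.
Qed.

(** Serves to compare two results of [inst]: the argument lists have equal length and are read in
    reverse, and past their end both sides return the same index, related by [HBnd]. *)
Lemma inst_nth_Forall2 (G : signature) (P : mterm G -> mterm G -> Prop)
    (ss ss' : list (mterm G)) (HBnd : forall i, P (Bnd i) (Bnd i)) :
  Forall2 P ss ss' -> forall i,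
  P (nth i (rev ss) (Bnd (i - length ss)))
    (nth i (rev ss') (Bnd (i - length ss'))).
Proof.
  intros H i; rewrite <- (Forall2_length H); generalize (i - length ss).
  assert (Hr : Forall2 P (rev ss) (rev ss')).
  { clear i; induction H; simpl; auto using Forall2_app. }
  intro j; revert i; induction Hr; intros [|i]; simpl; auto.
Qed.

(** * Typing *)

Lemma Forall2_map_l_Forall (A B C : Type) (f : A -> B) (P : A -> C -> Prop)
    (Q : B -> C -> Prop) (l : list A) (l' : list C) :
  Forall (fun x => forall y, P x y -> Q (f x) y) l -> Forall2 P l l' ->
  Forall2 Q (map f l) l'.
Proof.
  intros H H'; induction H'; simpl; inversion H; subst; constructor; auto.
Qed.

Lemma has_type_ren (G : signature) (s : mterm G) :
  forall E E' r t, has_type E s t ->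
  (forall i a, nth_error E i = Some a -> nth_error E' (r i) = Some a) ->
  has_type E' (ren r s) t.
Proof.
  induction s using mterm_nested_ind; intros E E' r t Ht Hr;
    inversion Ht; subst; simpl; try (econstructor; eauto; fail).
  - constructor; eapply IHs; eauto; intros [|i] c; simpl; auto.
  - econstructor; eauto; eapply Forall2_map_l_Forall; eauto.
    eapply Forall_impl; eauto; simpl; eauto.
Qed.

Lemma has_type_ren_S (G : signature) (E : list (ty (sort G))) (a : ty (sort G))
    (s : mterm G) (t : ty (sort G)) :
  has_type E s t -> has_type (a :: E) (ren S s) t.
Proof. intro H; eapply has_type_ren; eauto. Qed.

Lemma has_type_subst (G : signature) (s : mterm G) :
  forall E E' g t, has_type E s t ->
  (forall i a, nth_error E i = Some a -> has_type E' (g i) a) ->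
  has_type E' (subst g s) t.
Proof.
  induction s using mterm_nested_ind; intros E E' g t Ht Hg;
    inversion Ht; subst; simpl; try (econstructor; eauto; fail); auto.
  - constructor; eapply IHs; eauto; intros [|i] c; simpl; intro Hc.
    + constructor; assumption.
    + apply has_type_ren_S; auto.
  - econstructor; eauto; eapply Forall2_map_l_Forall; eauto.
    eapply Forall_impl; eauto; simpl; eauto.
Qed.

(** With the empty set of rules [step] is pure beta reduction; [step_mono] embeds it in the
    reduction of any set of rules. *)
Definition no_rule {G : signature} (l r : mterm G) : Prop := False.

Lemma beta_has_type (G : signature) (E : list (ty (sort G))) (s s' : mterm G) :
  step no_rule E s s' -> forall t, has_type E s t -> has_type E s' t.
Proof.
  induction 1 as [E l r d HF|E a s u|E s s' u H IH|E s u u' H IH|E a s s' H IH];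
    intros t Ht.
  - destruct HF.
  - inversion Ht as [| | |? ? b ? Hs Hu| |]; subst.
    inversion Hs; subst; eapply has_type_subst; eauto.
    intros [|i] c Hc; simpl in *; [congruence|].
    (* Past the single argument [nth] returns its default, the index lowered by one because a binder
       has disappeared. *)
    rewrite Nat.sub_0_r; destruct i; constructor; assumption.
  - inversion Ht; subst; econstructor; eauto.
  - inversion Ht; subst; econstructor; eauto.
  - inversion Ht; subst; econstructor; eauto.
Qed.

Lemma beta_metas (G : signature) (E : list (ty (sort G))) (s s' : mterm G) :
  step no_rule E s s' -> metas s = [] -> metas s' = [].
Proof.
  induction 1 as [E l r d HF|E a s u|E s s' u H IH|E s u u' H IH|E a s s' H IH];
    simpl; intro Hm; try (apply app_eq_nil in Hm as [Hs Hu]); auto.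
  - destruct HF.
  - apply metas_subst_nil; auto; intros [|i]; simpl; auto.
    destruct i; reflexivity.
  - rewrite IH; auto.
  - rewrite IH, Hs; auto.
Qed.

Lemma beta_is_term (G : signature) (s s' : mterm G) :
  step no_rule [] s s' -> is_term s -> is_term s'.
Proof.
  intros H [Hm [t Ht]]; split; [|exists t];
    eauto using beta_metas, beta_has_type.
Qed.

Lemma step_mono (G : signature) (R R' : mterm G -> mterm G -> Prop)
    (E : list (ty (sort G))) (s s' : mterm G) :
  (forall l r, R l r -> R' l r) -> step R E s s' -> step R' E s s'.
Proof. induction 2; try (constructor; auto; fail). Qed.

(** * Spines *)

Lemma msubst_apps (G : signature) (d : mvar G -> mterm G) (ls : list (mterm G)) :
  forall a, msubst d (apps a ls) = apps (msubst d a) (map (msubst d) ls).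
Proof. induction ls; intro b; simpl; auto; apply IHls. Qed.

Lemma metas_apps (G : signature) (ls : list (mterm G)) :
  forall a, metas (apps a ls) = metas a ++ flat_map metas ls.
Proof.
  induction ls; intro b; simpl; [symmetry; apply app_nil_r|].
  etransitivity; [apply IHls|]; simpl; rewrite app_assoc; reflexivity.
Qed.

Lemma respects_at_apps (G : signature) (ar : fsym G -> nat)
    (ls : list (mterm G)) :
  forall n a, respects_at ar n (apps a ls) =
    respects_at ar (length ls + n) a && forallb (respects_at ar 0) ls.
Proof.
  induction ls; intros n b; simpl; [symmetry; apply andb_true_r|].
  etransitivity; [apply IHls|]; simpl.
  rewrite andb_assoc; reflexivity.
Qed.

Notation beta_star E := (clos_refl_trans _ (step no_rule E)).

Lemma clos_rt_map (A : Type) (P Q : A -> A -> Prop) (f : A -> A) :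
  (forall x y, P x y -> Q (f x) (f y)) ->
  forall x y, clos_refl_trans _ P x y -> clos_refl_trans _ Q (f x) (f y).
Proof. intro H; induction 1; eauto using clos_refl_trans. Qed.

Lemma step_apps (G : signature) (R : mterm G -> mterm G -> Prop)
    (E : list (ty (sort G))) (ls : list (mterm G)) :
  forall s s', step R E s s' -> step R E (apps s ls) (apps s' ls).
Proof. induction ls; simpl; auto using step. Qed.

(** * Eta-expansion *)

(** This is [lambda x1 .. xk. s x1 .. xk]. Each new variable is applied before the recursive call,
    so the later lifts shift its index and inductions run with [s] general. *)
Fixpoint eta {G : signature} (ss : list (ty (sort G))) (s : mterm G)
  : mterm G :=
  match ss with
  | [] => s
  | a :: ss => Lam a (eta ss (App (ren S s) (Bnd 0)))
  end.

Lemma subst_eta (G : signature) (ss : list (ty (sort G))) :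
  forall g s, subst g (eta ss s) = eta ss (subst g s).
Proof.
  induction ss; intros g s; simpl; auto.
  rewrite IHss; simpl; rewrite subst_up_ren; reflexivity.
Qed.

Lemma metas_eta_nil (G : signature) (ss : list (ty (sort G))) :
  forall s, metas s = [] -> metas (eta ss s) = [].
Proof.
  induction ss; intros s Hs; simpl; auto.
  apply IHss; simpl; rewrite metas_ren, Hs; reflexivity.
Qed.

Lemma has_type_eta (G : signature) (ss : list (ty (sort G))) (b : ty (sort G)) :
  forall E s, has_type E s (arrows ss b) -> has_type E (eta ss s) (arrows ss b).
Proof.
  induction ss; intros E s Hs; simpl in *; auto.
  constructor; apply IHss; econstructor.
  - apply has_type_ren_S; exact Hs.
  - constructor; reflexivity.
Qed.

Lemma respects_at_ren (G : signature) (ar : fsym G -> nat) (s : mterm G) :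
  forall n r, respects_at ar n (ren r s) = respects_at ar n s.
Proof.
  induction s using mterm_nested_ind; intros n r; simpl; auto.
  - rewrite IHs1, IHs2; reflexivity.
  - induction H; simpl; congruence.
Qed.

Lemma respects_eta (G : signature) (ar : fsym G -> nat)
    (ss : list (ty (sort G))) :
  forall s, respects_at ar (length ss) s = true ->
  respects_at ar 0 (eta ss s) = true.
Proof.
  induction ss; intros s Hs; simpl in *; auto.
  apply IHss; simpl; rewrite respects_at_ren, Hs; reflexivity.
Qed.

(** One beta step with first argument [u] turns the expansion of [s] into the shorter expansion of
    [App s u]: the substitution cancels the lift of [s] and puts [u] for the bound variable. *)
Lemma beta_star_apps_eta (G : signature) (E : list (ty (sort G)))
    (ss : list (ty (sort G))) :
  forall s us, length ss <= length us ->
  beta_star E (apps (eta ss s) us) (apps s us).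
Proof.
  induction ss as [|a ss IH]; intros s us Hl; [apply rt_refl|].
  destruct us as [|u us]; simpl in *; [lia|].
  eapply rt_trans; [apply rt_step, step_apps, S_Beta|].
  replace (inst [u] (eta ss (App (ren S s) (Bnd 0)))) with (eta ss (App s u)).
  - apply (IH (App s u)); lia.
  - pose proof (inst1_ren u s) as Hs; unfold inst in *.
    rewrite subst_eta; simpl in *; rewrite Hs; reflexivity.
Qed.

(** * Expansion of symbols and of terms *)

Fixpoint first_args {S : Type} (n : nat) (t : ty S) : list (ty S) :=
  match n, t with
  | Datatypes.S n', Arr a b => a :: first_args n' b
  | _, _ => []
  end.

(** Since [first_args] stops at a sort, equality rests on the arity bound. It guarantees that [f]
    has enough arguments inside its own expansion. *)
Lemma length_first_args (S : Type) (n : nat) :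
  forall t : ty S, n <= nargs t -> length (first_args n t) = n.
Proof.
  induction n; intros [a|a b]; simpl; intro H; auto with arith; lia.
Qed.

Lemma length_first_args_le (S : Type) (n : nat) :
  forall t : ty S, length (first_args n t) <= n.
Proof.
  induction n; intros [a|a b]; simpl; auto with arith.
Qed.

Lemma arrows_first_args (S : Type) (n : nat) :
  forall t : ty S, exists b, t = arrows (first_args n t) b.
Proof.
  induction n; intros [a|a b]; simpl; eauto.
  destruct (IHn b) as [c Hc]; exists c; congruence.
Qed.

(* The redex keeps the expansion of a symbol from being an abstraction. *)
Definition sym_expansion {G : signature} (ar : fsym G -> nat) (f : fsym G)
  : mterm G :=
  App (Lam (ftype f) (Bnd 0)) (eta (first_args (ar f) (ftype f)) (Fun f)).

Lemma subst_sym_expansion (G : signature) (ar : fsym G -> nat) (f : fsym G)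
    (g : nat -> mterm G) :
  subst g (sym_expansion ar f) = sym_expansion ar f.
Proof. unfold sym_expansion; simpl; rewrite subst_eta; reflexivity. Qed.

Lemma has_type_sym_expansion (G : signature) (ar : fsym G -> nat) (f : fsym G)
    (E : list (ty (sort G))) :
  has_type E (sym_expansion ar f) (ftype f).
Proof.
  econstructor; [constructor; constructor; reflexivity|].
  destruct (arrows_first_args (ar f) (ftype f)) as [b Hb].
  (* [Hb] has [ftype f] on both sides; only the type is rewritten, the list of abstracted types must
     stay. *)
  rewrite Hb at 2; apply has_type_eta; rewrite <- Hb; constructor.
Qed.

(** Contracting the identity redex uncovers the eta-expansion, whose at most [ar f] abstractions are
    then consumed by the arguments. *)
Lemma beta_star_sym_expansion (G : signature) (ar : fsym G -> nat) (f : fsym G)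
    (E : list (ty (sort G))) (us : list (mterm G)) :
  ar f <= length us ->
  beta_star E (apps (sym_expansion ar f) us) (apps (Fun f) us).
Proof.
  intro Hl; eapply rt_trans; [apply rt_step, step_apps, S_Beta|].
  apply beta_star_apps_eta.
  etransitivity; [apply length_first_args_le|exact Hl].
Qed.

(* As in [respects_at], [n] counts the arguments to which [s] is applied. *)
Fixpoint expand {G : signature} (ar : fsym G -> nat) (n : nat) (s : mterm G)
  : mterm G :=
  match s with
  | Fun f => if ar f <=? n then Fun f else sym_expansion ar f
  | App s u => App (expand ar (S n) s) (expand ar 0 u)
  | Lam a s => Lam a (expand ar 0 s)
  | _ => s
  end.

(* Unlike [expand], this also allows expanding symbols that have enough
   arguments, which makes it stable under substitution. *)
Inductive expands {G : signature} (ar : fsym G -> nat)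
  : nat -> mterm G -> mterm G -> Prop :=
| X_Var (n : nat) (x : var G) : expands ar n (Var x) (Var x)
| X_Bnd (n : nat) (i : nat) : expands ar n (Bnd i) (Bnd i)
| X_Keep (n : nat) (f : fsym G) : ar f <= n -> expands ar n (Fun f) (Fun f)
| X_Expand (n : nat) (f : fsym G) : expands ar n (Fun f) (sym_expansion ar f)
| X_App (n : nat) (s s' u u' : mterm G) :
    expands ar (S n) s s' -> expands ar 0 u u' ->
    expands ar n (App s u) (App s' u')
| X_Lam (n : nat) (a : ty (sort G)) (s s' : mterm G) :
    expands ar 0 s s' -> expands ar n (Lam a s) (Lam a s').

Lemma expand_expands (G : signature) (ar : fsym G -> nat) (s : mterm G) :
  forall n, metas s = [] -> expands ar n s (expand ar n s).
Proof.
  induction s; intros k Hs; simpl in *; try (constructor; auto; fail).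
  - destruct (Nat.leb_spec (ar f) k); constructor; assumption.
  - apply app_eq_nil in Hs as [? ?]; constructor; auto.
  - discriminate.
Qed.

(** A larger argument count only relaxes [X_Keep]. Relations obtained at count 0, for substituted
    values and contracta, therefore persist wherever these terms get applied. *)
Lemma expands_weaken (G : signature) (ar : fsym G -> nat) (n : nat)
    (s s' : mterm G) :
  expands ar n s s' -> forall m, n <= m -> expands ar m s s'.
Proof.
  induction 1; intros m Hm; constructor; auto; try lia.
  apply IHexpands1; lia.
Qed.

Lemma expands_metas (G : signature) (ar : fsym G -> nat) (n : nat)
    (s s' : mterm G) :
  expands ar n s s' -> metas s' = [].
Proof.
  induction 1; simpl; auto.
  - apply metas_eta_nil; reflexivity.
  - rewrite IHexpands1, IHexpands2; reflexivity.
Qed.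

Lemma expands_has_type (G : signature) (ar : fsym G -> nat) (n : nat)
    (s s' : mterm G) :
  expands ar n s s' ->
  forall E t, has_type E s t -> has_type E s' t.
Proof.
  induction 1; intros E t Ht; inversion Ht; subst;
    try apply has_type_sym_expansion; try (econstructor; eauto; fail).
Qed.

Lemma expands_is_term (G : signature) (ar : fsym G -> nat) (n : nat)
    (s s' : mterm G) :
  expands ar n s s' -> is_term s -> is_term s'.
Proof.
  intros H [_ [t Ht]]; split; [|exists t];
    eauto using expands_metas, expands_has_type.
Qed.

Lemma expand_respects (G : signature) (ar : fsym G -> nat) (Har : is_arity ar)
    (s : mterm G) :
  forall n, metas s = [] -> respects_at ar n (expand ar n s) = true.
Proof.
  induction s; intros k Hs; simpl in *; auto.
  - destruct (Nat.leb_spec (ar f) k); simpl.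
    + apply Nat.leb_le; assumption.
    + apply respects_eta; simpl; rewrite length_first_args; auto.
      apply Nat.leb_refl.
  - apply app_eq_nil in Hs as [? ?]; rewrite IHs1, IHs2; auto.
  - discriminate.
Qed.

(** The two sides differ only in symbols expanded despite having enough arguments, and beta removes
    these. Such a redex needs the arguments of its symbol, so the induction carries the pending ones
    in [us]. *)
Lemma beta_star_expand (G : signature) (ar : fsym G -> nat) (n : nat)
    (s s' : mterm G) :
  expands ar n s s' -> forall E us, length us = n ->
  beta_star E (apps s' us) (apps (expand ar n s) us).
Proof.
  induction 1 as [n x|n i|n f Hf|n f|n s s' u u' Hs IHs Hu IHu|n a s s' Hs IHs];
    intros E us Hus; simpl; try apply rt_refl.
  - apply Nat.leb_le in Hf; rewrite Hf; apply rt_refl.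
  - destruct (Nat.leb_spec (ar f) n).
    + apply beta_star_sym_expansion; lia.
    + apply rt_refl.
  - eapply rt_trans.
    + apply (IHs E (u' :: us)); simpl; congruence.
    + apply (clos_rt_map (P := step no_rule E)
        (f := fun v => apps (App (expand ar (S n) s) v) us));
        auto using step, step_apps.
      apply (IHu E []); reflexivity.
  - apply (clos_rt_map (P := step no_rule (a :: E))
      (f := fun v => apps (Lam a v) us)); auto using step, step_apps.
    apply (IHs (a :: E) []); reflexivity.
Qed.

Lemma expands_ren (G : signature) (ar : fsym G -> nat) (n : nat)
    (s s' : mterm G) (r : nat -> nat) :
  expands ar n s s' -> expands ar n (ren r s) (ren r s').
Proof.
  intro H; rewrite !ren_as_subst; revert r.
  induction H; intro r; simpl; rewrite ?up_Bnd, ?subst_eta;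
    try (constructor; auto; fail).
Qed.

(** A value replacing an index in function position gains arguments. A symbol at its head that was
    expanded for lack of arguments stays expanded, which [X_Expand] permits at every count. *)
Lemma expands_subst (G : signature) (ar : fsym G -> nat) (n : nat)
    (s s' : mterm G) :
  expands ar n s s' ->
  forall g g', (forall i, expands ar 0 (g i) (g' i)) ->
  expands ar n (subst g s) (subst g' s').
Proof.
  induction 1; intros g g' Hg; rewrite ?subst_sym_expansion;
    simpl; try (constructor; auto; fail).
  - eapply expands_weaken; eauto with arith.
  - constructor; apply IHexpands; intros [|i]; simpl; [constructor|].
    apply expands_ren; auto.
Qed.

Lemma expands_apps (G : signature) (ar : fsym G -> nat)
    (us us' : list (mterm G)) :
  Forall2 (expands ar 0) us us' ->
  forall n s s', expands ar (length us + n) s s' ->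
  expands ar n (apps s us) (apps s' us').
Proof.
  induction 1; intros n s s' Hs; simpl in *; auto.
  apply IHForall2; constructor; auto.
Qed.

(** Both terms have the same leading abstractions, because [sym_expansion] is an application; hence
    [body] takes the same branch on both. *)
Lemma expands_body (G : signature) (ar : fsym G -> nat) (e : nat) :
  forall w w', expands ar 0 w w' -> expands ar 0 (body e w) (body e w').
Proof.
  induction e; intros w w' Hw; [exact Hw|].
  inversion Hw; subst; try (apply IHe; assumption);
    (apply expands_apps;
      [ generalize (rev (seq 0 (S e))); intro l; induction l; simpl;
        constructor; [constructor|assumption]
      | eapply expands_weaken; [apply expands_ren; exact Hw|lia]]).
Qed.

(** Used for right-hand sides. The symbols of [s] itself are the same on both sides, and
    [respects_at] supplies the bound that [X_Keep] requires; only the values of the meta-variables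
    differ. *)
Lemma expands_msubst (G : signature) (ar : fsym G -> nat) (s : mterm G) :
  forall n d d', respects_at ar n s = true ->
  (forall Z, In Z (metas s) -> expands ar 0 (d Z) (d' Z)) ->
  expands ar n (msubst d s) (msubst d' s).
Proof.
  induction s using mterm_nested_ind; intros n d d' Hs Hd; simpl in *;
    try (constructor; fail).
  - constructor; apply Nat.leb_le; assumption.
  - apply andb_true_iff in Hs as [? ?].
    constructor; [apply IHs1|apply IHs2]; auto using in_or_app.
  - constructor; apply IHs; auto using expands_ren.
  - eapply expands_weaken with (n := 0); [|lia].
    apply expands_subst; [apply expands_body; auto|].
    apply inst_nth_Forall2; [constructor|].
    assert (Hm : forall Z0, In Z0 (flat_map metas ss) ->
      expands ar 0 (d Z0) (d' Z0)) by auto.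
    clear Hd; induction H; simpl in *; constructor;
      apply andb_true_iff in Hs as [? ?]; auto using in_or_app.
Qed.

(** * Left-hand sides *)

(** Putting variables for indices changes no symbol's argument count, so [expand] makes the same
    choices before and after. *)
Lemma expand_subst_var (G : signature) (ar : fsym G -> nat) (s : mterm G) :
  forall n g, (forall i, is_var (g i)) ->
  expand ar n (subst g s) = subst g (expand ar n s).
Proof.
  induction s; intros k g Hg; simpl; auto.
  - destruct (Hg n); reflexivity.
  - destruct (ar f <=? k); [|rewrite subst_sym_expansion]; reflexivity.
  - rewrite IHs1, IHs2; auto.
  - rewrite IHs; auto; intros [|i]; simpl; [constructor|].
    destruct (Hg i); constructor.
Qed.

Lemma expand_ren (G : signature) (ar : fsym G -> nat) (n : nat)
    (r : nat -> nat) (s : mterm G) :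
  expand ar n (ren r s) = ren r (expand ar n s).
Proof.
  rewrite !ren_as_subst; apply expand_subst_var; constructor.
Qed.

Lemma expand_apps (G : signature) (ar : fsym G -> nat) (ls : list (mterm G)) :
  forall n a, expand ar n (apps a ls) =
    apps (expand ar (length ls + n) a) (map (expand ar 0) ls).
Proof.
  induction ls; intros n b; simpl; [reflexivity|apply IHls].
Qed.

Lemma expand_lams (G : signature) (ar : fsym G -> nat)
    (ss : list (ty (sort G))) (s : mterm G) :
  expand ar 0 (lams ss s) = lams ss (expand ar 0 s).
Proof. induction ss; simpl; congruence. Qed.

Lemma body_lams (G : signature) (ss : list (ty (sort G))) (s : mterm G) :
  body (length ss) (lams ss s) = s.
Proof. induction ss; simpl; auto; destruct s; reflexivity. Qed.

Lemma ren_lams (G : signature) (ss : list (ty (sort G))) (s : mterm G) :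
  forall r, exists r', ren r (lams ss s) = lams ss (ren r' s).
Proof.
  induction ss; intro r; simpl; eauto.
  destruct (IHss (up_ren r)) as [r' Hr]; exists r'; congruence.
Qed.

(** An equality is required here, for the expanded term must again be an instance of [l]. The
    symbols of [l] have enough arguments and are kept, and a meta-variable of a pattern only renames
    the body of its value. *)
Lemma expand_msubst_pattern (G : signature) (ar : fsym G -> nat) (l : mterm G) :
  pattern l -> forall d, respects ar l ->
  (forall Z, In Z (metas l) -> exists u, d Z = lams (margs Z) u) ->
  expand ar 0 (msubst d l) = msubst (fun Z => expand ar 0 (d Z)) l.
Proof.
  pose (Q := fun l : mterm G => forall d, respects ar l ->
    (forall Z, In Z (metas l) -> exists u, d Z = lams (margs Z) u) ->
    expand ar 0 (msubst d l) = msubst (fun Z => expand ar 0 (d Z)) l).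
  assert (Hargs : forall d ls, Forall Q ls ->
    forallb (respects_at ar 0) ls = true ->
    (forall Z, In Z (flat_map metas ls) -> exists u, d Z = lams (margs Z) u) ->
    map (expand ar 0) (map (msubst d) ls) =
      map (msubst (fun Z => expand ar 0 (d Z))) ls).
  { intros d ls H; induction H as [|k ls Hk _ IH]; simpl; intros Hr Hd; auto.
    apply andb_true_iff in Hr as [? ?]; f_equal; auto using in_or_app. }
  revert l; apply (pattern_nested_ind (P := Q)).
  - intros Z xs Hl Hxs d _ Hd; simpl.
    (* [Z] has exactly [mar Z] arguments and [d Z] at least as many leading abstractions, so [body]
       strips those listed in [margs Z] and adds no variables. *)
    destruct (Hd Z) as [u Hu]; [left; reflexivity|].
    rewrite Hu, expand_lams, Hl; unfold mar; rewrite !body_lams.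
    assert (Hid : forall d, map (msubst d) xs = xs).
    { clear -Hxs; intro d; induction Hxs as [|? ? []]; simpl; congruence. }
    (* The arguments and the default values of [nth] are all variables. *)
    rewrite !Hid; apply expand_subst_var; intro i.
    destruct (nth_in_or_default i (rev xs) (Bnd (i - length xs))) as [H|H].
    + apply in_rev in H; revert H; apply Forall_forall; assumption.
    + rewrite H; constructor.
  - intros a l IH d Hr Hd; simpl; f_equal; rewrite IH; auto.
    (* Below the abstraction [msubst] lifts the values of [d]; lifting commutes with [expand] and
       preserves their leading abstractions. *)
    + f_equal; extensionality Z; apply expand_ren.
    + intros Z HZ; destruct (Hd Z HZ) as [u Hu]; rewrite Hu.
      destruct (ren_lams (margs Z) u S); eauto.
  - intros f ls IH d Hr Hd; red in Hr.
    rewrite respects_at_apps in Hr; apply andb_true_iff in Hr as [Hf Hls].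
    rewrite metas_apps in Hd.
    rewrite !msubst_apps, expand_apps, length_map, Hargs; auto.
    simpl in *; rewrite Hf; reflexivity.
  - intros x ls Hx IH d Hr Hd; red in Hr.
    rewrite respects_at_apps in Hr; apply andb_true_iff in Hr as [_ Hls].
    rewrite metas_apps in Hd.
    rewrite !msubst_apps, expand_apps, Hargs; auto using in_or_app.
    destruct Hx; reflexivity.
Qed.

(** The head symbol already has its [ar f] arguments inside [l], so further arguments from the
    context do not affect the expansion. *)
Lemma expand_msubst_lhs (G : signature) (ar : fsym G -> nat) (n : nat)
    (l : mterm G) (d : mvar G -> mterm G) :
  pattern l -> (exists f ls, l = apps (Fun f) ls) -> respects ar l ->
  (forall Z, In Z (metas l) -> exists u, d Z = lams (margs Z) u) ->
  expand ar n (msubst d l) = msubst (fun Z => expand ar 0 (d Z)) l.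
Proof.
  intros Hp [f [ls ->]] Hr Hd.
  rewrite <- expand_msubst_pattern; auto.
  red in Hr; rewrite respects_at_apps in Hr; apply andb_true_iff in Hr as [Hf _].
  rewrite msubst_apps, !expand_apps, length_map; simpl in *.
  rewrite Hf; apply Nat.leb_le in Hf.
  replace (ar f <=? length ls + n) with true; [reflexivity|].
  symmetry; apply Nat.leb_le; lia.
Qed.

(** * Simulation *)

(** The same redex is contracted, in the rule case with the expanded substitution. The result is
    related to [s'] only by [expands]: contraction can give an expanded symbol additional arguments,
    whereupon [expand] would have kept it. *)
Lemma step_expand (G : signature) (R : mterm G -> mterm G -> Prop)
    (ar : fsym G -> nat)
    (HR : forall l r : mterm G, R l r -> is_rule l r)
    (Hresp : forall l r : mterm G, R l r -> respects ar l /\ respects ar r)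
    (E : list (ty (sort G))) (s s' : mterm G) :
  step R E s s' -> metas s = [] -> forall n,
  exists t, step R E (expand ar n s) t /\ expands ar n s' t.
Proof.
  induction 1 as [E l r d HRlr Hd|E a s u|E s s' u H IH|E s u u' H IH|E a s s' H IH];
    simpl; intros Hm n; try (apply app_eq_nil in Hm as [Hs Hu]).
  - destruct (HR _ _ HRlr) as (_ & _ & _ & Hp & Hf & Hincl).
    destruct (Hresp _ _ HRlr) as [Hl Hr].
    exists (msubst (fun Z => expand ar 0 (d Z)) r); split.
    + rewrite expand_msubst_lhs; auto; [|intros Z HZ; apply (Hd Z HZ)].
      constructor; auto; intros Z HZ.
      destruct (Hd Z HZ) as (Hm' & Ht & u & Hu).
      pose proof (expand_expands ar 0 Hm') as HX; split; [|split].
      * eapply expands_metas; eauto.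
      * eapply expands_has_type; eauto.
      * rewrite Hu, expand_lams; eauto.
    + eapply expands_weaken with (n := 0); [|lia].
      apply expands_msubst; auto; intros Z HZ.
      (* By [Hincl] the meta-variables of [r] occur in [l], so [Hd] covers them. *)
      apply expand_expands; apply (Hd Z); auto.
  - exists (inst [expand ar 0 u] (expand ar 0 s)); split; [constructor|].
    eapply expands_weaken with (n := 0); [|lia].
    apply expands_subst; [apply expand_expands; assumption|].
    apply inst_nth_Forall2 with (P := expands ar 0); [constructor|].
    constructor; [apply expand_expands; assumption|constructor].
  - destruct (IH Hs (S n)) as [t [Ht Hx]].
    exists (App t (expand ar 0 u)); split; constructor; auto using expand_expands.
  - destruct (IH Hu 0) as [t [Ht Hx]].
    exists (App (expand ar (S n) s) t); split; constructor;
      auto using expand_expands.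
  - destruct (IH Hm 0) as [t [Ht Hx]].
    exists (Lam a t); split; constructor; assumption.
Qed.

(** * Infinite reductions by dependent choice *)

Lemma infinite_sequence (A : Type) (P : A -> Prop) (R : A -> A -> Prop) :
  (forall x, P x -> exists y, R x y /\ P y) ->
  forall x, P x -> exists u : nat -> A, u 0 = x /\ forall i, R (u i) (u (S i)).
Proof.
  intros H x Hx.
  (* Choosing in the subset type carries [P] along the iteration. *)
  assert (H' : forall p : {x | P x}, exists q : {x | P x},
    R (proj1_sig p) (proj1_sig q)).
  { intros [y Hy]; destruct (H y Hy) as [z [Hz Pz]]; exists (exist _ z Pz); exact Hz. }
  pose (next := fun p =>
    proj1_sig (constructive_indefinite_description _ (H' p))).
  exists (fun i => proj1_sig (Nat.iter i next (exist _ x Hx))).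
  split; [reflexivity|]; intro i; simpl; unfold next at 2.
  match goal with |- context [constructive_indefinite_description _ ?h] =>
    exact (proj2_sig (constructive_indefinite_description _ h)) end.
Qed.

Theorem theoremA8 (G : signature) (R : mterm G -> mterm G -> Prop)
    (ar : fsym G -> nat)
    (HR : forall l r : mterm G, R l r -> is_rule l r)
    (Har : is_arity ar)
    (Hresp : forall l r : mterm G, R l r -> respects ar l /\ respects ar r) :
  terminating R <->
  (forall s : mterm G, is_term s -> respects ar s -> terminating_term R s).
Proof.
  split; [intros H s Hs _; exact (H s Hs)|].
  intros H s Hs [u [Hu0 Hu]].
  assert (Hterm : forall i, is_term (u i)) by (intro i; apply (Hu i)).
  assert (Hexp : forall i, expands ar 0 (u i) (expand ar 0 (u i)))
    by (intro i; apply expand_expands; apply (Hterm i)).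
  apply (H (expand ar 0 s)).
  - rewrite <- Hu0; exact (expands_is_term (Hexp 0) (Hterm 0)).
  - apply expand_respects; [exact Har|apply Hs].
  (* Invariant: the current term is on a beta reduction towards the expansion of some [u i]. The
     closure [clos_refl_trans_1n] exposes the first step of that reduction. *)
  - apply (infinite_sequence (P := fun t => is_term t /\
      exists i, clos_refl_trans_1n _ (step no_rule []) t (expand ar 0 (u i)))).
    + intros t [Ht [i Hred]]; inversion Hred as [|t' ? Hstep Hrest]; subst.
      (* The expansion of [u i] has been reached: its step is simulated, and the contractum
         beta-reduces to the expansion of [u (S i)]. *)
      * destruct (Hu i) as (_ & _ & Hstep).
        destruct (step_expand HR Hresp Hstep (proj1 (Hterm i)) 0)
          as [t [Hst Hx]].
        pose proof (expands_is_term Hx (Hterm (S i))) as Ht'.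
        exists t; split; [repeat split; try apply Ht; try apply Ht'; exact Hst|].
        split; [exact Ht'|]; exists (S i).
        apply clos_rt_rt1n, (beta_star_expand Hx [] (us := []) eq_refl).
      (* Beta steps remain: the next one is performed and [i] stays. *)
      * pose proof (beta_is_term Hstep Ht) as Ht'.
        exists t'; split; [|split; eauto].
        repeat split; try apply Ht; try apply Ht'.
        eapply step_mono; [|exact Hstep]; intros l r [].
    + subst s; split; [exact (expands_is_term (Hexp 0) (Hterm 0))|].
      exists 0; apply rt1n_refl.
Qed.
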